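(* Let $G$ be a $2$-connected graph of order at least three. If $\sigma_2(G)\ge 2\widetilde{\alpha}(G)$, then $G$ is hamiltonian (i.e., $G$ contains a cycle through every vertex).
   Context: All graphs are finite and simple. For a graph $G$ that is not complete, $\sigma_2(G)=\min\{d_G(u)+d_G(v): u,v\in V(G),\ u\ne v,\ uv\notin E(G)\}$; if $G$ is complete, $\sigma_2(G)=\infty$. An $(s,t)$-bipartite-hole in $G$ consists of two disjoint vertex sets $S,T\subseteq V(G)$ with $|S|=s$, $|T|=t$ and no edge of $G$ having one endpoint in $S$ and the other in $T$. The bipartite-hole-number $\widetilde{\alpha}(G)$ is the minimum integer $k$ such that there exist positive integers $s,t$ with $s+t=k+1$ for which $G$ contains no $(s,t)$-bipartite-hole. *)

(* Defs.v *)
From mathcomp Require Import all_boot.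
Set Implicit Arguments. Unset Strict Implicit. Unset Printing Implicit Defensive.

Section Graphs.
Variable V : finType.
Implicit Types (e : rel V) (A S T : {set V}).

Definition simple_graph e := symmetric e /\ irreflexive e.

Definition deg e (v : V) : nat := #|[set u | e v u]|.

(* sigma_2(G) >= k.  sigma_2 is the minimum of d(u)+d(v) over distinct
   non-adjacent pairs, and +infinity when G is complete; so sigma_2 >= k
   means exactly that every such pair has degree sum >= k (vacuous for
   complete graphs). *)
Definition sigma2_ge e (k : nat) : Prop :=
  forall u v : V, u != v -> ~~ e u v -> k <= deg e u + deg e v.

Definition has_bhole e (s t : nat) : bool :=
  [exists S : {set V}, exists T : {set V},
     [&& [disjoint S & T], #|S| == s, #|T| == t &
         [forall x in S, forall y in T, ~~ e x y]]].

Definition bhn_ok e (k : nat) : bool :=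
  [exists s : 'I_k.+2, [&& 0 < s, s <= k & ~~ has_bhole e s (k.+1 - s)]].

Lemma bhn_ok_exists e : exists k, bhn_ok e k.
Proof.
exists #|V|.+1; apply/existsP.
have H1 : 1 < #|V|.+3 by [].
exists (Ordinal H1); rewrite /=.
apply/negP=> /existsP [S] /existsP [T] /and4P [_ _ /eqP HT _].
by move: (max_card T); rewrite HT subSS ltnn.
Qed.

Definition bhn e : nat := ex_minn (bhn_ok_exists e).

Definition connected_on e A : Prop :=
  forall x y, x \in A -> y \in A ->
    connect [rel a b | [&& e a b, a \in A & b \in A]] x y.

Definition k_connected e (k : nat) : Prop :=
  k < #|V| /\ forall X : {set V}, #|X| < k -> connected_on e (~: X).

Definition hamiltonian e : Prop :=
  exists c : seq V, [/\ uniq c, 3 <= size c, cycle e c & forall v, v \in c].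

End Graphs.

(* Main.v *)
(* Write k = s + t - 1 with no (s,t)-bipartite-hole, and add edges one at a
   time.  If x, y are non-adjacent, both of degree at least k, and G + xy is
   hamiltonian, then so is G: otherwise a Hamilton path from x to y, cut at the
   s-th neighbour of x, yields a hole between pieces of N(x) and N(y) shifted by
   one step along the path, since any edge between these pieces closes up a
   Hamilton cycle.  When no such pair is left, the vertices of degree at least k
   form a clique; those of degree less than k form a clique by the degree-sum
   condition; and a 2-connected graph covered by two cliques is hamiltonian. *)
Require Import Defs.
From mathcomp Require Import all_boot zify.
Set Implicit Arguments. Unset Strict Implicit. Unset Printing Implicit Defensive.

(** * Rerouting a path into a cycle *)

Section Cycles.
Variables (V : finType) (e : rel V).
Hypotheses (esym : symmetric e) (eirr : irreflexive e).
Implicit Types (A S T : {set V}) (p : seq V).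

Lemma path_rev a p : path e (last a p) (rev (belast a p)) = path e a p.
Proof. by rewrite rev_path; apply: eq_path => u v; rewrite esym. Qed.

Lemma last_rev_belast (a : V) p : last (last a p) (rev (belast a p)) = a.
Proof. by case: p => //= b p; rewrite rev_cons last_rcons. Qed.

Lemma rev_cons_last (a : V) p : rev (a :: p) = last a p :: rev (belast a p).
Proof. by rewrite lastI rev_rcons. Qed.

Lemma cycle_cat3 a p b q c r :
  path e a p -> path e b q -> path e c r ->
  e (last a p) b -> e (last b q) c -> e (last c r) a ->
  cycle e ((a :: p) ++ (b :: q) ++ (c :: r)).
Proof.
move=> pa pb pc h1 h2 h3.
by rewrite /= !(rcons_cat, rcons_cons, cat_path) /= cat_path /= rcons_path pa h1 pb h2 pc.
Qed.

(** The cycle runs the first segment backwards, the second forwards and the third backwards. *)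
Lemma cycle_swap_parallel a p b q c r :
  path e a (p ++ b :: q ++ c :: r) ->
  e a b -> e (last b q) (last c r) -> e (last a p) c ->
  cycle e (rev (a :: p) ++ (b :: q) ++ rev (c :: r)).
Proof.
rewrite cat_path /= cat_path /= => /and5P[pa _ pb _ pc] h1 h2 h3.
rewrite !rev_cons_last; apply: cycle_cat3; rewrite ?path_rev ?last_rev_belast //.
by rewrite esym.
Qed.

(** Here the neighbour [c] of the first end comes after the neighbour [b] of the last end: the
    second and third segments are run backwards, then the first forwards. *)
Lemma cycle_swap_crossing a p b q c r :
  path e a (p ++ b :: q ++ c :: r) ->
  e a c -> e (last c r) b -> e (last a p) (last b q) ->
  cycle e (rev (b :: q) ++ rev (c :: r) ++ (a :: p)).
Proof.
rewrite cat_path /= cat_path /= => /and5P[pa _ pb _ pc] h1 h2 h3.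
rewrite !rev_cons_last; apply: cycle_cat3; rewrite ?path_rev ?last_rev_belast //.
  by rewrite esym.
by rewrite esym.
Qed.

Lemma last_take_nth (x : V) p i : i <= size p -> last x (take i p) = nth x (x :: p) i.
Proof.
elim: p x i => [|a p IH] x [|i] //= hi.
by rewrite IH //; apply: set_nth_default.
Qed.

(** Positions are counted in [x :: p], where [x] has position 0; the segments occupy the positions
    below [i], from [i] to [j], and above [j]. *)
Lemma split3 (x : V) p i j : 0 < i <= j -> j < size p ->
  exists p1 b q c r, [/\ p = p1 ++ b :: q ++ c :: r,
    last x p1 = nth x (x :: p) i.-1, b = nth x (x :: p) i,
    last b q = nth x (x :: p) j & c = nth x (x :: p) j.+1].
Proof.
case: i => // i hij hj.
have hi : i < size p by lia.
(* [i] is now one less than before, hence the index of [b] in [p]; [m] counts the entries after [b]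
   up to position [j]. *)
pose d := drop i.+1 p; pose m := j - i.+1.
have hm : m < size d by rewrite /d size_drop /m; lia.
have dE : d = take m d ++ nth x d m :: drop m.+1 d.
  by rewrite -{1}(cat_take_drop m d) (drop_nth x hm).
exists (take i p), (nth x p i), (take m d), (nth x d m), (drop m.+1 d); split=> //.
- by rewrite -dE /d -(drop_nth x hi) cat_take_drop.
- by rewrite last_take_nth //= ltnW.
- rewrite last_take_nth ?(ltnW hm) // -(drop_nth x hi) nth_drop.
  rewrite (_ : i + m = j.-1); last by rewrite /m; lia.
  by case: (j) hij hj => //= j' _ hj'; apply: set_nth_default; lia.
- by rewrite /d nth_drop /=; congr nth; rewrite /m; lia.
Qed.

(** * Bipartite holes from a Hamilton path *)

Lemma bhole_of_large S T s t : [disjoint S & T] -> s <= #|S| -> t <= #|T| ->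
  (forall u v, u \in S -> v \in T -> ~~ e u v) -> has_bhole e s t.
Proof.
move=> dST /card_geqP[ls [us ss sS]] /card_geqP[lt [ut st tT]] h.
apply/existsP; exists [set z in ls]; apply/existsP; exists [set z in lt].
apply/and4P; split.
- apply: (disjointWl _ (disjointWr _ dST)); apply/subsetP=> z; rewrite inE.
    exact: sS.
  exact: tT.
- by rewrite cardsE (card_uniqP us) ss.
- by rewrite cardsE (card_uniqP ut) st.
apply/forall_inP=> u; rewrite inE => /sS uS; apply/forall_inP=> v.
by rewrite inE => /tT; apply: h.
Qed.

Lemma deg_split z (P : pred V) :
  #|[set w | e z w & P w]| + #|[set w | e z w & ~~ P w]| = deg e z.
Proof.
rewrite /deg -[RHS](cardsID [set w | P w]); congr (_ + _); apply: eq_card => w; rewrite !inE //.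
by rewrite andbC.
Qed.

(** Let [q] be the position of the [s]-th neighbour of [x]. Either the other end [y] has at least
    [t] neighbours from [q] on, or counting degrees leaves [s] neighbours of [y] before [q] and [t]
    of [x] from [q] on. In each case shifting the two sets gives a hole. *)
Lemma bhole_of_path x p s t :
  path e x p -> uniq (x :: p) ->
  ~~ e x (last x p) -> 0 < s -> 0 < t ->
  s + t <= (deg e x).+1 -> s + t <= (deg e (last x p)).+1 ->
  (forall v, v \in x :: p) ->
  (forall q, perm_eq q (x :: p) -> ~~ cycle e q) -> has_bhole e s t.
Proof.
move=> pth unq nxy s0 t0 dx dy all nocyc.
set y := last x p in nxy dy *.
pose c := x :: p; pose v k := nth x c k; pose ix w := index w c.
have vix w : v (ix w) = w by apply: nth_index.
have ixv k : k <= size p -> ix (v k) = k by move=> hk; apply: index_uniq.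
have ixle w : ix w <= size p by rewrite -ltnS -[X in _ < X]/(size c) index_mem.
have yv : y = v (size p) by rewrite /v /c nth_last.
(* Neighbours of either end lie strictly inside the path, so shifts by one step stay on it. *)
have ix1 w : e x w -> 0 < ix w < size p.
  move=> exw; have := ixle w; have := vix w; case: (ix w) => [|k].
    by rewrite /v /= => xw; rewrite -xw eirr in exw.
  move=> kw hk /=; rewrite ltn_neqAle hk andbT; apply/eqP=> kE.
  by move: exw nxy; rewrite yv -kE kw => ->.
have ix2 w : e y w -> 0 < ix w < size p.
  move=> exw; have := ixle w; have := vix w; case: (ix w) => [|k].
    by rewrite /v /= => xw; rewrite -xw esym (negPf nxy) in exw.
  move=> kw hk /=; rewrite ltn_neqAle hk andbT; apply/eqP=> kE.
  by move: exw; rewrite yv -kE kw eirr.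
have parallel w w' : e x w -> e y w' -> ix w <= ix w' ->
    ~~ e (v (ix w).-1) (v (ix w').+1).
  move=> xw yw le; have /andP[i0 _] := ix1 _ xw; have /andP[_ jn] := ix2 _ yw.
  have [|p1 [b [q [d [r [pE ap1 bE bq dE]]]]]] := split3 x (i := ix w) (j := ix w') _ jn.
    by rewrite i0.
  have yE : y = last d r by rewrite /y pE !last_cat /= last_cat.
  have perm : perm_eq (rev (x :: p1) ++ (b :: q) ++ rev (d :: r)) (x :: p).
    rewrite pE -cat_cons; apply: perm_cat; first by rewrite perm_rev.
    by apply: (perm_cat (perm_refl (b :: q))); rewrite perm_rev.
  apply: contra (nocyc _ perm) => euv; apply: cycle_swap_parallel.
  - by rewrite -pE.
  - by rewrite bE -/(v _) vix.
  - by rewrite bq -/(v _) vix -yE esym.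
  - by rewrite ap1 dE.
have crossing w w' : e x w -> e y w' -> ix w' < ix w ->
    ~~ e (v (ix w').-1) (v (ix w).-1).
  move=> xw yw lt; have /andP[_ iN] := ix1 _ xw; have /andP[j0 _] := ix2 _ yw.
  (* The third segment starts at [w] itself, so the second ends at [(ix w).-1]. *)
  have [||p1 [b [q [d [r [pE ap1 bE bq dE]]]]]] :=
    split3 x (p := p) (i := ix w') (j := (ix w).-1); [lia|lia|].
  have yE : y = last d r by rewrite /y pE !last_cat /= last_cat.
  have perm : perm_eq (rev (b :: q) ++ rev (d :: r) ++ (x :: p1)) (x :: p).
    rewrite pE -cat_cons catA perm_catC perm_cat2l.
    by apply: (@perm_cat _ _ (b :: q) _ (d :: r)); rewrite perm_rev.
  apply: contra (nocyc _ perm) => euv; apply: cycle_swap_crossing.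
  - by rewrite -pE.
  - by rewrite dE prednK ?(leq_ltn_trans _ lt) // -/(v _) vix.
  - by rewrite bE -/(v _) vix -yE.
  - by rewrite ap1 bq.
(* Positivity matters because [.-1] sends both 0 and 1 to 0. *)
have card_prev (A : {set V}) : (forall w, w \in A -> 0 < ix w) ->
    #|[set v (ix w).-1 | w in A]| = #|A|.
  move=> hA; apply: card_in_imset => w w' /hA i0 /hA j0 /(congr1 ix).
  have := ixle w; have := ixle w'; move=> h1 h2.
  rewrite !ixv; [|lia|lia] => h; rewrite -(vix w) -(vix w'); congr v; lia.
have card_next (A : {set V}) : (forall w, w \in A -> ix w < size p) ->
    #|[set v (ix w).+1 | w in A]| = #|A|.
  move=> hA; apply: card_in_imset => w w' /hA i0 /hA j0 /(congr1 ix).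
  by rewrite !ixv // => -[h]; rewrite -(vix w) -(vix w') h.
have exF : exists q, s <= #|[set w | e x w & ix w <= q]|.
  exists (size p).
  have -> : [set w | e x w & ix w <= size p] = [set w | e x w].
    by apply/setP=> w; rewrite !inE ixle andbT.
  by rewrite -/(deg e x); lia.
case: (ex_minnP exF) => q sq qmin.
have ltq : #|[set w | e x w & ix w < q]| < s.
  case: q qmin {sq} => [|q] qmin.
    by rewrite (eq_card0 (A := [set w | e x w & ix w < 0])) // => w; rewrite inE andbF.
  by rewrite ltnNge; apply/negP => /qmin; rewrite ltnn.
have [ty | ty] := leqP t #|[set w | e y w & q <= ix w]|.
  (* The predecessors sit below position [q] and the successors above it, whence disjointness. *)
  apply: (@bhole_of_large [set v (ix w).-1 | w in [set w | e x w & ix w <= q]]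
                          [set v (ix w).+1 | w in [set w | e y w & q <= ix w]]).
  - rewrite -setI_eq0; apply/set0Pn => -[u /setIP[/imsetP[w + ->] /imsetP[w' +]]].
    rewrite !inE => /andP[/ix1 h1 h2] /andP[/ix2 h3 h4] /(congr1 ix).
    rewrite !ixv; lia.
  - by rewrite card_prev // => w; rewrite inE => /andP[/ix1/andP[]].
  - by rewrite card_next // => w; rewrite inE => /andP[/ix2/andP[]].
  - move=> _ _ /imsetP[w + ->] /imsetP[w' + ->]; rewrite !inE.
    move=> /andP[xw h1] /andP[yw h2]; apply: parallel => //; exact: leq_trans h2.
(* At most [t - 1] neighbours of [y] lie from [q] on and at most [s - 1] of [x] before [q]; the
   degree bounds leave at least [s] and [t] on the opposite sides. *)
have := deg_split x (fun w => ix w < q); have := deg_split y (fun w => q <= ix w).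
move=> dyE dxE.
apply: (@bhole_of_large [set v (ix w).-1 | w in [set w | e y w & ~~ (q <= ix w)]]
                        [set v (ix w).-1 | w in [set w | e x w & ~~ (ix w < q)]]).
- rewrite -setI_eq0; apply/set0Pn => -[u /setIP[/imsetP[w + ->] /imsetP[w' +]]].
  rewrite !inE => /andP[/ix2 h1 h2] /andP[/ix1 h3 h4] /(congr1 ix).
  rewrite !ixv; lia.
- rewrite card_prev; first lia.
  by move=> w; rewrite inE => /andP[/ix2/andP[]].
- rewrite card_prev; first lia.
  by move=> w; rewrite inE => /andP[/ix1/andP[]].
- move=> _ _ /imsetP[w + ->] /imsetP[w' + ->]; rewrite !inE.
  move=> /andP[yw h1] /andP[xw h2]; apply: crossing => //; lia.
Qed.

(** A Hamilton cycle is searched for among the permutations of the path; if none closes up, a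
    forbidden hole appears. *)
Lemma hamiltonian_of_path x p s t :
  path e x p -> uniq (x :: p) -> (forall v, v \in x :: p) -> 2 <= size p ->
  ~~ e x (last x p) -> 0 < s -> 0 < t -> ~~ has_bhole e s t ->
  s + t <= (deg e x).+1 -> s + t <= (deg e (last x p)).+1 -> hamiltonian e.
Proof.
move=> pth unq all sp nxy s0 t0 nhole dx dy.
have [/hasP[q] | nocyc] := boolP (has (cycle e) (permutations (x :: p))).
  rewrite mem_permutations => pq cq; exists q; split=> //.
  - by rewrite (perm_uniq pq).
  - by rewrite (perm_size pq).
  - by move=> v; rewrite (perm_mem pq).
case/negP: nhole; apply: (bhole_of_path pth) => // q pq.
by apply: (hasPn nocyc); rewrite mem_permutations.
Qed.

(** * Graphs covered by two cliques *)

Lemma connected_on_crossing A C a b : connected_on e C ->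
  a \in C -> a \in A -> b \in C -> b \notin A ->
  exists u v, [/\ e u v, u \in C :&: A & v \in C :\: A].
Proof.
move=> conn aC aA bC; have /connectP[p pth ->] := conn _ _ aC bC.
elim: p a aC aA pth => [|z p IH] a aC aA /=; first by rewrite aA.
case/andP=> /and3P[eaz _ zC] pth; have [zA|zA _] := boolP (z \in A); first exact: IH.
by exists a, z; rewrite !inE aC aA zA zC.
Qed.

Definition clique A := forall u v, u \in A -> v \in A -> u != v -> e u v.

(** Any listing of a clique without repetition is a path, so [u] is put first and [v] last. *)
Lemma clique_path A u v : clique A -> u \in A -> v \in A -> (u = v -> A = [set u]) ->
  exists p, [/\ path e u p, uniq (u :: p), last u p = v & u :: p =i A].
Proof.
move=> cA uA vA uvA.
have clique_sorted a p : {subset a :: p <= A} -> uniq (a :: p) -> path e a p.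
  elim: p a => //= b p IH a sub /and3P[ab bp up].
  rewrite IH ?andbT /= ?bp //; last by move=> z zp; apply: sub; rewrite inE zp orbT.
  apply: cA; rewrite ?sub ?inE ?eqxx ?orbT //.
  by apply: contraNneq ab => ->; rewrite inE eqxx.
have [uv|uv] := eqVneq u v.
  by exists [::]; split=> // z; rewrite (uvA uv) !inE.
pose p := rcons (enum (A :\ u :\ v)) v.
have mem : u :: p =i A.
  move=> z; rewrite inE mem_rcons inE mem_enum !inE.
  have [->|_] /= := eqVneq z u; first by rewrite uA.
  by have [->|_] := eqVneq z v; rewrite ?vA.
have un : uniq (u :: p).
  by rewrite /= mem_rcons inE rcons_uniq enum_uniq !mem_enum !inE !eqxx (negPf uv) andbF.
exists p; split=> //; last by rewrite last_rcons.
by apply: clique_sorted => // z; rewrite mem.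
Qed.

(** Hamilton paths of the two cliques close up along the two crossing edges, which may share an end
    only if that end is its whole clique. *)
Lemma hamiltonian_of_joined_cliques A l1 l2 h1 h2 : 2 < #|V| -> clique A -> clique (~: A) ->
  l1 \in A -> l2 \in A -> h1 \notin A -> h2 \notin A -> e l1 h1 -> e l2 h2 ->
  (l1 = l2 -> A = [set l1]) -> (h1 = h2 -> ~: A = [set h1]) -> hamiltonian e.
Proof.
move=> V3 cA cB l1A l2A h1A h2A e1 e2 lA hA.
have [p [pth up lp mp]] := clique_path cA l1A l2A lA.
have [|||q [qth uq lq mq]] := clique_path cB (u := h2) (v := h1); rewrite ?inE //.
  by move=> hE; rewrite hE; apply: hA.
have un : uniq ((l1 :: p) ++ (h2 :: q)).
  rewrite cat_uniq up uq andbT; apply/hasPn => z; rewrite mp mq inE //.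
have all z : z \in (l1 :: p) ++ (h2 :: q) by rewrite mem_cat mp mq inE orbN.
exists ((l1 :: p) ++ (h2 :: q)); split=> //.
  by rewrite -(card_uniqP un) (eq_card (B := V)).
by rewrite /= rcons_cat rcons_cons cat_path /= rcons_path pth lp e2 qth lq esym.
Qed.

Lemma hamiltonian_of_clique : 2 < #|V| -> clique [set: V] -> hamiltonian e.
Proof.
move=> V3 cV; have /card_gt1P[u [v [_ _ uv]]] : 1 < #|V| by apply: ltnW.
have [|||p [pth un lp all]] := clique_path cV (u := u) (v := v); rewrite ?inE //.
  by move=> uvE; rewrite uvE eqxx in uv.
exists (u :: p); split=> //=.
- rewrite -[(size p).+1]/(size (u :: p)) -(card_uniqP un) (eq_card (B := V)) // => z.
  by rewrite all inE.
- by rewrite rcons_path pth lp cV ?inE // eq_sym.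
- by move=> z; rewrite all inE.
Qed.

Lemma set1_or_other A l : l \in A -> A = [set l] \/ exists2 a, a \in A & a != l.
Proof.
move=> lA; have [A0|[a]] := set_0Vmem (A :\ l).
  by left; rewrite -(setD1K lA) A0 setU0.
by rewrite !inE => /andP[al aA]; right; exists a.
Qed.

(** Deleting at most one vertex keeps an edge between the cliques as long as both stay nonempty;
    deleting ends of edges already found yields a suitable pair. *)
Lemma hamiltonian_of_two_cliques A :
  k_connected e 2 -> 2 < #|V| -> clique A -> clique (~: A) -> hamiltonian e.
Proof.
move=> [_ conn] V3 cA cB.
have edge (X : {set V}) a b : #|X| < 2 -> a \in A :\: X -> b \notin A -> b \notin X ->
    exists u v, [/\ e u v, u \in A :\: X & v \notin A /\ v \notin X].
  move=> X2 /setDP[aA aX] bA bX.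
  have [||u [v [euv]]] := connected_on_crossing (conn _ X2) (a := a) _ aA _ bA;
    rewrite ?inE //.
  by move=> /andP[uX uA] /andP[vA vX]; exists u, v; rewrite !inE uX uA.
have [A0|[a aA]] := set_0Vmem A.
  by apply: hamiltonian_of_clique => //; rewrite -setC0 -A0.
have [B0|[b]] := set_0Vmem (~: A).
  by apply: hamiltonian_of_clique => //; rewrite -setC0 -B0 setCK.
rewrite inE => bA.
have [||||l1 [h1 [e1 /setDP[l1A _] [h1A _]]]] := edge set0 a b; rewrite ?cards0 ?inE ?aA //.
have join := hamiltonian_of_joined_cliques V3 cA cB.
have h1B : h1 \in ~: A by rewrite inE.
have [BE|[b' + b'h1]] := set1_or_other h1B; last first.
  rewrite inE => b'A.
  have [||||l3 [h3 [e3 /setDP[l3A _] [h3A]]]] := edge [set h1] l1 b';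
    rewrite ?cards1 ?inE ?l1A ?andbT //.
    by apply: contraNneq h1A => <-.
  move=> h31; have [l31|l31] := eqVneq l3 l1; last first.
    by apply: (join l3 l1 h3 h1) => // E; rewrite E eqxx in l31 h31.
  have [AE|[a' a'A a'l1]] := set1_or_other l1A.
    apply: (join l3 l1 h3 h1) => //; first by rewrite l31.
    by move=> E; rewrite E eqxx in h31.
  (* Both edges found so far meet at [l1]; deleting it gives a third one with a new end in [A]. *)
  have [||||l2 [h2 [e2 /setDP[l2A l21] [h2A _]]]] := edge [set l1] a' h1;
    rewrite ?cards1 ?inE ?a'l1 ?a'A //.
    by apply: contraNneq h1A => ->.
  rewrite inE in l21.
  (* The third edge misses [h1] or [h3], and is paired with the earlier edge at the vertex it
     misses. *)
  have [h21|h21] := eqVneq h2 h1.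
    apply: (join l2 l3 h2 h3) => //; first by move=> E; rewrite E l31 eqxx in l21.
    by move=> E; rewrite -E h21 eqxx in h31.
  apply: (join l2 l1 h2 h1) => // E; first by rewrite E eqxx in l21.
  by rewrite E eqxx in h21.
(* The complement is now [[set h1]], so [A] has a second vertex because [#|V|] exceeds 2. *)
have [AE|[a' a'A a'l1]] := set1_or_other l1A.
  by move: V3; rewrite -(cardsC A) BE AE !cards1.
have [||||l2 [h2 [e2 /setDP[l2A l21] [h2A _]]]] := edge [set l1] a' h1;
  rewrite ?cards1 ?inE ?a'l1 ?a'A //.
  by apply: contraNneq h1A => ->.
rewrite inE in l21.
have h21 : h2 = h1 by apply/set1P; rewrite -BE inE.
apply: (join l2 l1 h2 h1) => //; last by rewrite h21.
by move=> E; rewrite E eqxx in l21.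
Qed.

End Cycles.

(** * Adding edges one at a time *)

Section EdgeAddition.
Variable V : finType.
Implicit Type e : rel V.

Definition add_edge e (u v : V) : rel V :=
  [rel x y | [|| e x y, (x == u) && (y == v) | (x == v) && (y == u)]].

Lemma add_edge_simple e u v : u != v -> simple_graph e -> simple_graph (add_edge e u v).
Proof.
move=> uv [esym eirr]; split=> [x y|x] /=.
  by rewrite /add_edge /= esym; congr orb; rewrite orbC; congr orb; rewrite andbC.
rewrite /add_edge /= eirr /=.
by apply/negP => /orP[] /andP[/eqP xu /eqP xv]; move: uv; rewrite -xu -xv eqxx.
Qed.

Lemma k_connected_subrel e e' k : subrel e e' -> k_connected e k -> k_connected e' k.
Proof.
move=> sub [kV conn]; split=> // X Xk x y xX yX.
apply: connect_sub (conn X Xk x y xX yX) => a b /= /and3P[eab aX bX].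
by apply: connect1; rewrite /= sub ?aX.
Qed.

Lemma has_bhole_subrel e e' s t : subrel e e' -> has_bhole e' s t -> has_bhole e s t.
Proof.
move=> sub /existsP[S /existsP[T /and4P[d Ss Tt h]]].
apply/existsP; exists S; apply/existsP; exists T; rewrite d Ss Tt /=.
apply/forall_inP=> x xS; apply/forall_inP=> y yT.
by have /forall_inP/(_ y yT) := forall_inP h x xS; apply: contra; apply: sub.
Qed.

Lemma leq_deg_subrel e e' x : subrel e e' -> deg e x <= deg e' x.
Proof. by move=> sub; apply/subset_leq_card/subsetP => y; rewrite !inE; apply: sub. Qed.

Lemma sigma2_ge_subrel e e' k : subrel e e' -> sigma2_ge e k -> sigma2_ge e' k.
Proof.
move=> sub sig u v uv nuv; apply: leq_trans (sig u v uv _) _.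
  by apply: contra nuv; apply: sub.
by apply: leq_add; apply: leq_deg_subrel.
Qed.

(** Started at [u], the cycle can use the new edge only in its first or last step; removing that
    edge leaves a Hamilton path between [u] and [v]. *)
Lemma cycle_add_edge e u v c : simple_graph e -> u != v ->
  uniq c -> 2 < size c -> (forall x, x \in c) -> cycle (add_edge e u v) c ->
  hamiltonian e \/ exists x p, [/\ path e x p, uniq (x :: p), (forall z, z \in x :: p),
    size p = (size c).-1 & (x = u /\ last x p = v) \/ (x = v /\ last x p = u)].
Proof.
move=> [esym eirr] uv uc sc ac; have [i c' cE] := rot_to (ac u).
have {ac}all z : z \in u :: c' by rewrite -cE mem_rot.
rewrite -(rot_cycle i) cE; rewrite -(rot_uniq i) cE in uc; rewrite -(size_rot i) cE in sc *.
case: c' {cE} uc sc all => [|b [|b' q]] // uc sc all.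
have path_off r a : u \notin a :: r -> path (add_edge e u v) a r -> path e a r.
  elim: r a => //= a' r IH a; rewrite /add_edge /= !inE negb_or => /andP[ua ur].
  rewrite eq_sym (negPf ua) /= => /andP[eaa /IH -> //]; rewrite andbT.
  move: eaa ur; rewrite negb_or [u == a']eq_sym => /orP[//|/andP[_ /eqP->]].
  by rewrite eqxx.
set r := b' :: q in uc sc all *.
have /= /andP[ub ur] := uc.
rewrite -[X in X -> _]/(is_true (path (add_edge e u v) u (rcons (b :: r) u))) rcons_path.
case/andP=> /andP[eub].
move=> /(path_off _ _ ub) pb ezu.
set z := last b r in ezu.
have zr : z \in r by rewrite /z /= mem_last.
have nub : b != u by apply: contraNneq ub => ->; rewrite inE eqxx.
have nuz : z != u by apply: contraNneq ub => <-; rewrite inE zr orbT.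
(* With at least three vertices, the two neighbours of [u] on the cycle differ, so at most one of
   them is [v]. *)
have nbz : b != z by case/andP: ur => + _; apply: contraNneq => ->.
move: eub ezu; rewrite /add_edge /= !eqxx (negPf nub) (negPf nuz) (negPf uv) /= ?andbF ?andbT ?orbF.
have [eub|_ /=] := boolP (e u b).
  have [ezu|_ /= _ /eqP zv] := boolP (e z u).
    move=> _ _; left; exists (u :: b :: r); split=> //.
    by rewrite /= -[_ && path _ _ _]/(path e b (rcons r u)) rcons_path eub pb.
  right; exists u, (b :: r); split=> //; first by rewrite /= -[_ && path _ _ _]/(path e b r) eub.
  by left.
move=> /eqP bv; rewrite -bv [z == b]eq_sym (negPf nbz) orbF => ezu; right.
exists b, (rcons r u); rewrite rcons_path last_rcons size_rcons -rcons_cons; split=> //.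
- by rewrite pb.
- by rewrite -[_ && _]/(uniq (rcons (b :: r) u)) rcons_uniq ub.
- by move=> w; rewrite mem_rcons; apply: all.
- by right.
Qed.

Lemma hamiltonian_add_edge e u v s t : simple_graph e -> u != v -> ~~ e u v ->
  0 < s -> 0 < t -> ~~ has_bhole e s t ->
  s + t <= (deg e u).+1 -> s + t <= (deg e v).+1 ->
  hamiltonian (add_edge e u v) -> hamiltonian e.
Proof.
move=> simp uv nuv s0 t0 nhole du dv [c [uc sc cc ac]].
have [esym eirr] := simp.
have [|[x [p [pth un all sp xv]]]] // := cycle_add_edge simp uv uc sc ac cc.
have xl : [/\ ~~ e x (last x p), s + t <= (deg e x).+1 & s + t <= (deg e (last x p)).+1].
  by case: xv => [] [-> ->]; split; rewrite // esym.
case: xl => nxl dx dl; apply: (hamiltonian_of_path esym eirr pth) nhole dx dl => //.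
by rewrite sp; case: (c) sc.
Qed.

(** Induction on the number of non-adjacent ordered pairs: the hypotheses survive the new edge, and
    the Hamilton cycle is pulled back. *)
Lemma hamiltonian_of_no_bhole e s t : simple_graph e -> k_connected e 2 -> 2 < #|V| ->
  0 < s -> 0 < t -> ~~ has_bhole e s t -> sigma2_ge e (2 * (s + t).-1) -> hamiltonian e.
Proof.
move=> simp conn V3 s0 t0 nhole sig.
have [n] := ubnP #|[set q | ~~ e q.1 q.2]|.
elim: n e simp conn nhole sig => // n IH e simp conn nhole sig ltn.
pose H := [set z | s + t <= (deg e z).+1].
have [/existsP[u /existsP[v /and4P[uH vH uv nuv]]]|noHH] :=
  boolP [exists u, exists v, [&& u \in H, v \in H, u != v & ~~ e u v]].
  rewrite !inE in uH vH; have sub : subrel e (add_edge e u v).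
    by move=> x y; rewrite /add_edge /= => ->.
  apply: (hamiltonian_add_edge simp uv nuv s0 t0 nhole uH vH); apply: IH.
  - exact: add_edge_simple.
  - exact: k_connected_subrel conn.
  - by apply: contra nhole; apply: has_bhole_subrel.
  - exact: sigma2_ge_subrel sig.
  - rewrite (leq_trans _ (ltnSE ltn)) //; apply/proper_card/properP; split.
      by apply/subsetP => q; rewrite !inE; apply: contra; apply: sub.
    by exists (u, v); rewrite !inE /= // /add_edge /= !eqxx orbT.
have [esym _] := simp.
apply: (hamiltonian_of_two_cliques esym (A := H)) => // u v.
  move=> uH vH uv; apply: contraNT noHH => nuv.
  by apply/existsP; exists u; apply/existsP; exists v; rewrite uH vH uv nuv.
(* Degrees outside [H] are at most [s + t - 2], too small for the bound on degree sums. *)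
rewrite !inE -!ltnNge => uL vL uv; apply/negPn/negP => /(sig u v uv).
lia.
Qed.

End EdgeAddition.

Theorem mainTheorem1 (V : finType) (e : rel V) :
  simple_graph e -> k_connected e 2 -> 3 <= #|V| ->
  sigma2_ge e (2 * bhn e) -> hamiltonian e.
Proof.
(* The second size is [t = k.+1 - s], so [(s + t).-1] is [k], the value of [bhn e]. *)
move=> simp conn V3; rewrite /bhn; case: ex_minnP => k /existsP[s /and3P[s0 sk nhole]] _ sig.
apply: (hamiltonian_of_no_bhole simp conn V3 s0 _ nhole); first by rewrite subn_gt0.
by rewrite subnKC // ltnW.
Qed.
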